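(* Consider the Continuous model with maximum speed $s_{\max}$. When the execution graph $G=(V,E)$ is a tree rooted in a task $T_0\in V$ (edges directed from each task to its children), the optimal solution to $\mathrm{MinEnergy}(G,D)$ can be computed in polynomial time $O(|V|^2)$ (counting arithmetic operations, comparisons and cube roots on real numbers at unit cost; the algorithm reports that there is no solution when the problem is infeasible).
   Context: An execution graph is a finite directed acyclic graph $G=(V,E)$ whose vertices are tasks; task $T_i$ has a cost $w_i>0$. An edge $(T_i,T_j)\in E$ means that $T_j$ cannot start before $T_i$ is completed (the graph already contains both the application precedences and the ordering between successive tasks on the same processor, so no other resource constraint is needed). $D>0$ is a deadline. A task $T_i$ run at constant speed $s_i>0$ has duration $d_i=w_i/s_i$ and consumes energy $s_i^3 d_i=w_i s_i^2$. A solution consists of an admissible speed $s_i$ and a completion time $t_i$ for each task such that $t_i\ge d_i$ and $t_i\le D$ for every task $T_i$, and $t_i+d_j\le t_j$ for every edge $(T_i,T_j)\in E$. The problem $\mathrm{MinEnergy}(G,D)$ is to find a solution minimizing $\sum_i w_i s_i^2$. In the Continuous model the admissible speeds are all real numbers in $(0,s_{\max}]$. *)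

(* Defs.v *)
From HB Require Import structures.
From mathcomp Require Import all_boot all_order all_algebra.
From mathcomp Require Import reals exp.

Set Implicit Arguments.
Unset Strict Implicit.
Unset Printing Implicit Defensive.
Import Order.TTheory GRing.Theory Num.Theory.
Local Open Scope ring_scope.

Definition edge n (E : {set 'I_n * 'I_n}) : rel 'I_n :=
  fun i j => (i, j) \in E.

Definition acyclic (T : eqType) (e : rel T) :=
  forall p : seq T, cycle e p -> p = [::].

(* Edges go from parent to child: the root has no parent, every other vertex
   has exactly one, and everything is reachable from the root. *)
Definition tree_rooted_in (T : finType) (e : rel T) (r : T) :=
  (forall v, connect e r v) /\
  (forall v, #|[set u | e u v]| = (v != r) :> nat).

Section MinEnergy.
Variables (R : realType) (n : nat).
Variables (admissible : R -> Prop).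
Variables (w : 'I_n -> R) (E : {set 'I_n * 'I_n}) (D : R).

Definition duration (s : 'I_n -> R) (i : 'I_n) : R := w i / s i.

Definition solution (s t : 'I_n -> R) :=
  [/\ forall i, admissible (s i),
      forall i, duration s i <= t i /\ t i <= D
    & forall i j, edge E i j -> t i + duration s j <= t j].

Definition energy (s : 'I_n -> R) : R := \sum_(i < n) w i * s i ^+ 2.

Definition min_energy (s t : 'I_n -> R) :=
  solution s t /\
  (forall s' t', solution s' t' -> energy s <= energy s').

End MinEnergy.

Definition continuous_speed (R : realType) (smax x : R) := 0 < x /\ x <= smax.

Definition cbrt (R : realType) (x : R) : R := Num.sg x * `|x| `^ (3%:R^-1).

Lemma cbrtK (R : realType) (x : R) : cbrt x ^+ 3 = x.
Proof.
have [->|x0] := eqVneq x 0; first by rewrite /cbrt sgr0 mul0r expr0n.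
rewrite /cbrt exprMn -(powR_mulrn 3 (powR_ge0 _ _)) -powRrM mulVf ?pnatr_eq0 //.
by rewrite powRr1 // exprS sqr_sg x0 mulr1 -numEsg.
Qed.

(* A structured real RAM.  The memory consists of countably many integer
   arrays and countably many real arrays, a scalar variable being cell 0 of an
   array; a program is a fixed finite term, independent of the instance, so it
   uses finitely many of them.  Integers serve as indices and counters only:
   they are never added or multiplied, so after k steps they exceed the input
   size and the constants of the program by at most k.  Reals cannot be
   converted to integers. *)

Inductive iexp : Type :=
| IConst of nat
| IGet of nat & iexp
| ISucc of iexp
| IPred of iexp.

Inductive rexp : Type :=
| RConst of nat
| RGet of nat & iexp
| RAdd of rexp & rexp
| RSub of rexp & rexp
| RMul of rexp & rexp
| RDiv of rexp & rexp
| RCbrt of rexp.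

Inductive bexp : Type :=
| BIlt of iexp & iexp
| BRlt of rexp & rexp
| BNot of bexp.

(* [IPut a i e] stores e at index i of integer array a; [RPut] likewise. *)
Inductive cmd : Type :=
| Skip
| IPut of nat & iexp & iexp
| RPut of nat & iexp & rexp
| Seq of cmd & cmd
| If of bexp & cmd & cmd
| While of bexp & cmd.

(* The cost of evaluating an expression is its number of nodes. *)
Fixpoint icost (e : iexp) : nat :=
  match e with
  | IConst _ => 1%N
  | IGet _ i => (icost i).+1
  | ISucc e => (icost e).+1
  | IPred e => (icost e).+1
  end.

Fixpoint rcost (e : rexp) : nat :=
  match e with
  | RConst _ => 1%N
  | RGet _ i => (icost i).+1
  | RAdd e1 e2 | RSub e1 e2 | RMul e1 e2 | RDiv e1 e2 =>
      (rcost e1 + rcost e2).+1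
  | RCbrt e => (rcost e).+1
  end.

Fixpoint bcost (b : bexp) : nat :=
  match b with
  | BIlt e1 e2 => (icost e1 + icost e2).+1
  | BRlt e1 e2 => (rcost e1 + rcost e2).+1
  | BNot b => (bcost b).+1
  end.

Section Semantics.
Variable R : realType.

Record store : Type := Store {
  ints : nat -> nat -> nat;
  reals : nat -> nat -> R
}.

Definition upd (A : Type) (m : nat -> nat -> A) (a i : nat) (x : A) :=
  fun b j => if (b == a) && (j == i) then x else m b j.

Definition iput (st : store) a i x := Store (upd (ints st) a i x) (reals st).
Definition rput (st : store) a i x := Store (ints st) (upd (reals st) a i x).

Fixpoint ieval (st : store) (e : iexp) : nat :=
  match e with
  | IConst k => k
  | IGet a i => ints st a (ieval st i)
  | ISucc e => (ieval st e).+1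
  | IPred e => (ieval st e).-1
  end.

Definition lift2 (A B C : Type) (f : A -> B -> option C)
    (x : option A) (y : option B) : option C :=
  obind (fun a => obind (f a) y) x.

(* Division by zero is an error, on which the whole program gets stuck. *)
Fixpoint reval (st : store) (e : rexp) : option R :=
  match e with
  | RConst k => Some k%:R
  | RGet a i => Some (reals st a (ieval st i))
  | RAdd e1 e2 =>
      lift2 (fun x y => Some (x + y)) (reval st e1) (reval st e2)
  | RSub e1 e2 =>
      lift2 (fun x y => Some (x - y)) (reval st e1) (reval st e2)
  | RMul e1 e2 =>
      lift2 (fun x y => Some (x * y)) (reval st e1) (reval st e2)
  | RDiv e1 e2 =>
      lift2 (fun x y => if y == 0 then None else Some (x / y))
        (reval st e1) (reval st e2)
  | RCbrt e => omap (@cbrt R) (reval st e)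
  end.

Fixpoint beval (st : store) (b : bexp) : option bool :=
  match b with
  | BIlt e1 e2 => Some (ieval st e1 < ieval st e2)%N
  | BRlt e1 e2 =>
      lift2 (fun x y => Some (x < y)) (reval st e1) (reval st e2)
  | BNot b => omap negb (beval st b)
  end.

(* [exec c st st' k]: run from st, the command c terminates without error in
   the store st' after k elementary steps. *)
Inductive exec : cmd -> store -> store -> nat -> Prop :=
| ExecSkip st : exec Skip st st 1%N
| ExecIPut a i e st :
    exec (IPut a i e) st (iput st a (ieval st i) (ieval st e))
      (icost i + icost e).+1
| ExecRPut a i e st x :
    reval st e = Some x ->
    exec (RPut a i e) st (rput st a (ieval st i) x) (icost i + rcost e).+1
| ExecSeq c1 c2 st st1 st2 k1 k2 :
    exec c1 st st1 k1 -> exec c2 st1 st2 k2 ->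
    exec (Seq c1 c2) st st2 (k1 + k2)%N
| ExecIf b c1 c2 st st' v k :
    beval st b = Some v -> exec (if v then c1 else c2) st st' k ->
    exec (If b c1 c2) st st' (bcost b + k).+1
| ExecWhileDone b c st :
    beval st b = Some false -> exec (While b c) st st (bcost b).+1
| ExecWhileLoop b c st st1 st2 k1 k2 :
    beval st b = Some true ->
    exec c st st1 k1 -> exec (While b c) st1 st2 k2 ->
    exec (While b c) st st2 (bcost b + k1 + k2).+1.

Lemma exec_det c st st1 st2 k1 k2 :
  exec c st st1 k1 -> exec c st st2 k2 -> st1 = st2 /\ k1 = k2.
Proof.
move=> H; elim: H st2 k2 => {c st st1 k1}.
- by move=> st st2 k2; inversion 1.
- by move=> a i e st st2 k2; inversion 1.
- by move=> a i e st x Hx st2 k2; inversion 1; subst; split=> //; congruence.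
- move=> c1 c2 st st1 st1' k1 k1' _ IH1 _ IH2 st2 k2.
  inversion 1 as [| | |? ? ? ? ? ? ? E1 E2| | |]; subst.
  have [? ?] := IH1 _ _ E1; subst.
  by have [-> ->] := IH2 _ _ E2.
- move=> b c1 c2 st st' v k Hb _ IH st2 k2.
  inversion 1 as [| | | |? ? ? ? ? v' ? Hb' E| |]; subst.
  move: Hb' E; rewrite Hb => -[<-] E.
  by have [-> ->] := IH _ _ E.
- by move=> b c st Hb st2 k2; inversion 1; subst=> //; congruence.
- move=> b c st st1 st1' k1 k1' Hb _ IH1 _ IH2 st2 k2.
  inversion 1 as [| | | | | |? ? ? ? ? ? ? Hb' E1 E2]; subst.
    by congruence.
  have [? ?] := IH1 _ _ E1; subst.
  by have [-> ->] := IH2 _ _ E2.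
Qed.

(* Input: integer array 0 holds n, array 1 the number of edges, arrays 2 and 3
   the tails and heads of the listed edges; real array 0 holds the costs,
   array 1 the deadline, array 2 the maximum speed.  The root is not given.
   All other cells are 0. *)
Definition input (n : nat) (w : 'I_n -> R) (es : seq ('I_n * 'I_n))
    (D smax : R) : store :=
  Store
    (fun a k => match a with
      | 0 => if k == 0%N then n else 0%N
      | 1 => if k == 0%N then size es else 0%N
      | 2 => nth 0%N [seq val e.1 | e <- es] k
      | 3 => nth 0%N [seq val e.2 | e <- es] k
      | _ => 0%N
      end)
    (fun a k => match a with
      | 0 => if insub k is Some i then w i else 0
      | 1 => if k == 0%N then D else 0
      | 2 => if k == 0%N then smax else 0
      | _ => 0
      end).

(* Output: cell 0 of integer array 0 is 0 to report that there is no solution;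
   otherwise real array 0 holds the speeds and array 1 the completion times. *)
Definition output (n : nat) (st : store) :
    option (('I_n -> R) * ('I_n -> R)) :=
  if ints st 0%N 0%N == 0%N then None
  else Some (fun i => reals st 0%N (val i), fun i => reals st 1%N (val i)).

End Semantics.

(* Main.v *)
(* Give a task the equivalent weight W_i = w_i + (sum_c W_c^3)^(1/3), c ranging
   over its children: without the speed limit, the subtree of i optimally
   executed from time q to D starts at speed W_i / (D - q), and speeds do not
   increase towards the leaves.  With the limit, take
   s_i = min(smax, W_i / (D - q_i)), or smax if q_i >= D, where q_i is the
   completion time of the parent.
   The ancestors of a task running at smax also run at smax, so no solution
   completes such a task earlier; all others meet the deadline by
   construction, which settles feasibility.

   For optimality, compare with another solution (s', t') and put u = t' - t.
   Convexity bounds the energy loss of s by 2 sum_i s_i^3 (d'_i - d_i), and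
   summation by parts along the edges turns this into at most
   2 sum_i u_i (s_i^3 - sum_c s_c^3).  Each term is nonpositive: at a leaf
   t_i = D, so u_i <= 0; at an inner task slower than smax the cubes balance; at
   an inner task running at smax, u_i >= 0 and the cubes of the children
   dominate.

   Weights and times are computed by simultaneous relaxation: as the graph is
   acyclic, n rounds fix the weights and n more fix the times, a round taking
   linear time because a tree has at most n edges. *)

Require Import Defs.
From mathcomp Require Import all_boot all_order all_algebra.
From mathcomp Require Import reals exp.
From mathcomp Require Import zify ring lra.
Set Implicit Arguments.
Unset Strict Implicit.
Unset Printing Implicit Defensive.
Import Order.TTheory GRing.Theory Num.Theory.
Local Open Scope ring_scope.

(** * Acyclic relations and fixpoints of local operators *)

Lemma acyclic_path_uniq (T : eqType) (e : rel T) (x : T) (p : seq T) :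
  acyclic e -> path e x p -> uniq (x :: p).
Proof.
move=> acyc; elim: p x => [//|y p IH] x /= /andP[exy yp].
rewrite -[(y \notin p) && _]/(uniq (y :: p)) (IH y yp) andbT.
apply/negP => xp; have : path e x (y :: p) by rewrite /= exy.
case/splitPr: xp => p1 p2; rewrite cat_path /= => /and3P[xp1 lx _].
suff : cycle e (x :: p1) by move/acyc.
by rewrite /= rcons_path xp1.
Qed.

Lemma acyclic_rev (T : eqType) (e : rel T) :
  acyclic e -> acyclic (fun x y => e y x).
Proof.
move=> acyc p; rewrite -rev_cycle => /acyc /(congr1 size).
by rewrite size_rev => /size0nil.
Qed.

(** The value at [i] is settled after [k] rounds once every path leaving [i] has fewer than [k]
    edges. Paths of an acyclic relation repeat no vertex, so [#|T|] rounds settle all values. *)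
Lemma iter_local_fixpoint (T : finType) (A : Type) (e : rel T)
    (F : (T -> A) -> T -> A) (f : T -> A) :
  acyclic e ->
  (forall g h i, (forall j, e i j -> g j = h j) -> F g i = F h i) ->
  F (iter #|T| F f) =1 iter #|T| F f.
Proof.
move=> acyc Floc.
suff step k i : (forall p, path e i p -> (size p < k)%N) ->
    F (iter k F f) i = iter k F f i.
  move=> i; apply: step => p /(acyclic_path_uniq acyc) /card_uniqP /= <-.
  exact: max_card.
elim: k i => [|k IH] i short; first by have := short [::] isT.
apply: Floc => j eij; apply: IH => p jp.
by have := short (j :: p); rewrite /= eij => /(_ jp).
Qed.

(** * Rooted trees: induction from the root, sums over parents, edge count *)

Section Tree.
Variables (T : finType) (e : rel T) (r : T).
Hypothesis tree : tree_rooted_in e r.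

Lemma tree_ind (P : T -> Prop) :
  P r -> (forall u v, e u v -> P u -> P v) -> forall v, P v.
Proof.
move=> Pr Pe v; have /connectP[p rp ->] := tree.1 v.
elim: p r rp Pr => [//|y p IH] x /= /andP[exy yp] Px.
exact: IH yp (Pe _ _ exy Px).
Qed.

Lemma sum_parents_root (V : nmodType) (f : T -> V) : \sum_(u | e u r) f u = 0.
Proof.
have := tree.2 r; rewrite eqxx => /eqP; rewrite cards_eq0 => /eqP E0.
by apply: big_pred0 => u; move/setP/(_ u): E0; rewrite !inE.
Qed.

Lemma parent_unique u u' v : e u v -> e u' v -> u = u'.
Proof.
move=> euv eu'v; have : (#|[set x | e x v]| <= 1)%N by rewrite tree.2; case: eqP.
by move/card_le1_eqP; apply; rewrite inE.
Qed.

Lemma sum_parents (V : nmodType) (f : T -> V) u v :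
  e u v -> \sum_(x | e x v) f x = f u.
Proof.
move=> euv; rewrite (bigD1 u) //= big1 ?addr0 // => x /andP[exv].
by rewrite (parent_unique exv euv) eqxx.
Qed.

(** Sending an edge to its head is injective, as parents are unique. *)
Lemma tree_edge_card (E : {set T * T}) :
  (forall u v, ((u, v) \in E) = e u v) -> (#|E| <= #|T|)%N.
Proof.
move=> eE; rewrite -(card_in_imset (f := snd) (D := E)) ?max_card //.
move=> [u v] [u' v'] /=; rewrite !eE => euv eu'v' /= ?; subst v'.
by rewrite (parent_unique euv eu'v').
Qed.

End Tree.

Lemma cbrt_ge0 (R : realType) (x : R) : 0 <= x -> 0 <= cbrt x.
Proof. by move=> x0; rewrite /cbrt mulr_ge0 ?powR_ge0 // sgr_ge0. Qed.

(* The tangent line of the convex function [d |-> w^3 / d^2], expressed with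
   speeds [w / d]. *)
Lemma energy_tangent (R : realFieldType) (w s s' : R) :
  0 < w -> 0 < s -> 0 < s' ->
  w * s ^+ 2 <= w * s' ^+ 2 + 2 * (s ^+ 3 * (w / s' - w / s)).
Proof.
move=> w0 s0 s'0; rewrite -subr_ge0.
have -> : w * s' ^+ 2 + 2 * (s ^+ 3 * (w / s' - w / s)) - w * s ^+ 2 =
    w * ((s' - s) ^+ 2 * (s' + 2 * s)) / s' by field; rewrite !gt_eqF.
apply: divr_ge0 (ltW s'0); rewrite mulr_ge0 ?(ltW w0) // mulr_ge0 ?sqr_ge0 //.
by lra.
Qed.

(** * The operators computing weights and schedule, and their fixpoint *)

Section Schedule.
Variables (R : realType) (n : nat) (w : 'I_n -> R) (e : rel 'I_n).
Variables (D smax : R).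

Definition weights (W : 'I_n -> R) (i : 'I_n) : R :=
  w i + cbrt (\sum_(c | e i c) W c ^+ 3).

Definition speed (W q : R) : R :=
  if W < smax * (D - q) then W / (D - q) else smax.

(** In a tree the sum [q] has at most one term: it is the completion time of the parent, and 0 at
    the root. *)
Definition schedule (W : 'I_n -> R) (y : 'I_n -> R * R) (i : 'I_n) : R * R :=
  let q := \sum_(u | e u i) (y u).2 in
  let s := speed (W i) q in (s, q + w i / s).

Definition relax (x : ('I_n -> R) * ('I_n -> R * R)) :=
  (weights x.1, schedule (weights x.1) x.2).

Lemma weights_gt0 W : (forall i, 0 < w i) -> (forall i, 0 <= W i) ->
  forall i, 0 < weights W i.
Proof.
move=> w0 W0 i; rewrite ltr_wpDr // cbrt_ge0 // sumr_ge0 // => c _.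
by rewrite exprn_ge0.
Qed.

Lemma speed_gt0 W q : 0 < smax -> 0 < W -> 0 < speed W q.
Proof.
move=> s0 W0; rewrite /speed; case: (ltP W) => // lt; rewrite divr_gt0 //.
by rewrite -(pmulr_rgt0 _ s0) (lt_trans W0).
Qed.

(** Weights evolve independently of the times and look only at children, so the first [n] rounds
    freeze them. The schedule then iterates a fixed operator that looks only at parents, hence local
    for the reversed relation. *)
Lemma iter_relax_fixpoint x : acyclic e ->
  let z := iter n relax (iter n relax x) in
  weights z.1 =1 z.1 /\ schedule z.1 z.2 =1 z.2.
Proof.
move=> acyc /=; set x1 := iter n relax x.
have fstE k y : (iter k relax y).1 = iter k weights y.1.
  by elim: k => //= k ->.
have wloc g h i : (forall j, e i j -> g j = h j) -> weights g i = weights h i.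
  by move=> gh; rewrite /weights; congr (_ + cbrt _); apply: eq_bigr => c /gh ->.
have W1 : weights x1.1 =1 x1.1.
  rewrite fstE -[n in iter n]card_ord; exact: (iter_local_fixpoint _ acyc).
have Wk k : (iter k relax x1).1 =1 x1.1.
  elim: k => //= k IH i; rewrite -W1; apply: wloc => j _; exact: IH.
have sloc W W' g h i : W i = W' i -> (forall j, e j i -> g j = h j) ->
    schedule W g i = schedule W' h i.
  move=> WW gh; rewrite /schedule WW.
  by have -> : \sum_(u | e u i) (g u).2 = \sum_(u | e u i) (h u).2
    by apply: eq_bigr => u /gh ->.
have sndE k : (iter k relax x1).2 =1 iter k (schedule x1.1) x1.2.
  elim: k => //= k IH i; apply: sloc => [|j _]; last exact: IH.
  by rewrite -W1; apply: wloc => j _; exact: Wk.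
have fix2 : schedule x1.1 (iter n (schedule x1.1) x1.2)
    =1 iter n (schedule x1.1) x1.2.
  rewrite -[n in iter n]card_ord.
  apply: (iter_local_fixpoint _ (acyclic_rev acyc)) => g h i gh.
  exact: sloc.
split=> i; first by rewrite Wk -W1; apply: wloc => j _; exact: Wk.
by rewrite sndE -fix2; apply: sloc => [|j _]; [exact: Wk | exact: sndE].
Qed.

End Schedule.

(** * Feasibility and optimality of the fixpoint schedule *)

Section Optimality.
Variables (R : realType) (n : nat) (w : 'I_n -> R) (E : {set 'I_n * 'I_n}).
Variables (D smax : R) (T0 : 'I_n) (W s t : 'I_n -> R).
Hypotheses (w_gt0 : forall i, 0 < w i) (smax_gt0 : 0 < smax).
Hypotheses (tree : tree_rooted_in (edge E) T0) (W_ge0 : forall i, 0 <= W i).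

Notation e := (edge E).
Let q i : R := \sum_(u | e u i) t u.

Hypothesis WE : forall i, weights w e W i = W i.
Hypothesis sE : forall i, speed D smax (W i) (q i) = s i.
Hypothesis tE : forall i, q i + w i / s i = t i.

(** The equivalent weight of everything below [i]; it vanishes at leaves. *)
Let C i : R := W i - w i.
Let sat i := smax * (D - q i) <= W i.

Let W_gt0 i : 0 < W i. Proof. by rewrite -WE weights_gt0. Qed.

Let s_gt0 i : 0 < s i. Proof. by rewrite -sE speed_gt0. Qed.

Let C3 i : C i ^+ 3 = \sum_(c | e i c) W c ^+ 3.
Proof. by rewrite /C -{1}WE /weights addrC addKr cbrtK. Qed.

Let C_ge0 i : 0 <= C i.
Proof.
rewrite /C -{1}WE /weights addrC addKr cbrt_ge0 // sumr_ge0 // => c _.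
by rewrite exprn_ge0.
Qed.

Let leW_C i c : e i c -> W c <= C i.
Proof.
move=> eic; rewrite -(@ler_pXn2r _ 3) ?nnegrE // C3 (bigD1 c) //= lerDl.
by rewrite sumr_ge0 // => j _; rewrite exprn_ge0.
Qed.

Let q_child i c : e i c -> q c = t i.
Proof. exact: (sum_parents tree). Qed.

Let s_sat i : sat i -> s i = smax.
Proof. by rewrite -sE /speed /sat; case: ltP. Qed.

Let s_unsat i : ~~ sat i -> 0 < D - q i /\ s i = W i / (D - q i).
Proof.
rewrite -ltNge -sE /speed => lt; rewrite lt; split=> //.
by rewrite -(pmulr_rgt0 _ smax_gt0) (lt_trans (W_gt0 i)).
Qed.

Let le_s_smax i : s i <= smax.
Proof.
have [/s_sat -> //|ns] := boolP (sat i); have [R0 ->] := s_unsat ns.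
by rewrite ler_pdivrMr // ltW // ltNge.
Qed.

(** Task [i] uses the share [w i / W i] of the time [D - q i]; the share [C i / W i] remains. *)
Let left_unsat i : ~~ sat i -> D - t i = (D - q i) * C i / W i.
Proof.
move=> /s_unsat[R0 si]; rewrite -tE si /C; field.
by rewrite !gt_eqF.
Qed.

(** If [i] is unsaturated, full speed during the remaining time [D - t i] would do more than [C i],
    hence more than [W c]. *)
Let sat_parent i c : e i c -> sat c -> sat i.
Proof.
move=> eic; apply: contraTT => ns; rewrite -ltNge (q_child eic) left_unsat //.
apply: le_lt_trans (leW_C eic) _.
rewrite mulrA ltr_pdivlMr // mulrA mulrC ltr_pM2r ?ltNge //.
by rewrite -ltNge (lt_le_trans (W_gt0 c)) ?leW_C.
Qed.

Section Comparison.
Variables s' t' : 'I_n -> R.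
Hypothesis sol' : solution (continuous_speed smax) w E D s' t'.

Let s'_gt0 i : 0 < s' i. Proof. by case: sol' => /(_ i)[]. Qed.

Let le_duration i : w i / smax <= w i / s' i.
Proof.
by case: sol' => /(_ i)[s0 s1] _ _; rewrite ler_pM2l // lef_pV2 // posrE.
Qed.

(** Saturation passes up to the root, so the whole chain of ancestors runs at full speed without
    waiting. *)
Lemma sat_completion_le i : sat i -> t i <= t' i.
Proof.
have [_ dur prec] := sol'.
elim/(tree_ind tree): i => [|u v euv IH] satv; rewrite -tE s_sat //.
  rewrite /q (sum_parents_root tree) add0r.
  exact: le_trans (le_duration _) (dur T0).1.
rewrite (q_child euv); apply: le_trans (prec _ _ euv).
by rewrite lerD ?IH ?(sat_parent euv) // le_duration.
Qed.

(** The contrapositive justifies the infeasibility report: one late task rules out every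
    solution. *)
Lemma schedule_meets_deadline i : t i <= D.
Proof.
have [/sat_completion_le ti|ns] := boolP (sat i).
  by case: sol' => _ /(_ i)[_ ?] _; exact: le_trans ti _.
have [R0 _] := s_unsat ns.
by rewrite -subr_ge0 left_unsat // divr_ge0 // mulr_ge0 // ltW.
Qed.

Let flow_sign i : (t' i - t i) * (s i ^+ 3 - \sum_(c | e i c) s c ^+ 3) <= 0.
Proof.
have le_tD := schedule_meets_deadline i.
have [c eic|leaf] := pickP (e i); last first.
  have C0 : C i = 0.
    have /eqP : C i ^+ 3 = 0 by rewrite C3 big_pred0.
    by rewrite expf_eq0 => /andP[_ /eqP].
  rewrite [X in _ * (_ - X)]big_pred0 // subr0.
  rewrite mulr_le0_ge0 ?exprn_ge0 ?(ltW (s_gt0 i)) //.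
  rewrite subr_le0; have [_ /(_ i)[_ t'D] _] := sol'; apply: le_trans t'D _.
  (* At a leaf [W i = w i]: an unsaturated one ends exactly at [D], and a saturated one cannot end
     before [D]. *)
  have [si|ns] := boolP (sat i); last first.
    by rewrite -subr_le0 left_unsat // C0 mulr0 mul0r.
  rewrite -tE s_sat // -lerBlDl ler_pdivlMr // mulrC.
  by have -> : w i = W i by apply/eqP; rewrite eq_sym -subr_eq0; apply/eqP.
have Cgt0 : 0 < C i by apply: lt_le_trans (W_gt0 c) (leW_C eic).
(* Unsaturated children share the start [t i], so their speeds have the common denominator
   [D - t i]. *)
have sum_unsat : (forall c, e i c -> ~~ sat c) ->
    \sum_(c | e i c) s c ^+ 3 = (C i / (D - t i)) ^+ 3.
  move=> ns; rewrite expr_div_n C3 mulr_suml; apply: eq_bigr => j eij.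
  by have [_ ->] := s_unsat (ns _ eij); rewrite (q_child eij) expr_div_n.
have [si|ns] := boolP (sat i); last first.
  rewrite sum_unsat => [|j eij]; last exact: contra (sat_parent eij) ns.
  have [R0 ->] := s_unsat ns; rewrite left_unsat //.
  rewrite [X in _ - X ^+ 3](_ : _ = W i / (D - q i)) ?subrr ?mulr0 //.
  by field; rewrite !gt_eqF.
rewrite mulr_ge0_le0 ?subr_ge0 ?sat_completion_le // subr_le0 s_sat //.
(* A single saturated child already contributes [smax ^+ 3]. Otherwise saturation of [i] yields
   [smax * (D - t i) <= C i]. *)
have [j /andP[eij sj]|ns] := pickP (fun j => e i j && sat j).
  rewrite (bigD1 j) //= (s_sat sj) lerDl sumr_ge0 // => k _.
  by rewrite exprn_ge0 // ltW.
have nsj j : e i j -> ~~ sat j by move=> eij; have /negbT := ns j; rewrite eij.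
rewrite sum_unsat // ler_pXn2r ?nnegrE //; last 2 first.
- exact: ltW.
- by rewrite divr_ge0 // subr_ge0.
have [R0 _] := s_unsat (nsj _ eic); rewrite (q_child eic) in R0.
rewrite ler_pdivlMr // /C lerBrDr; apply: (le_trans _ si).
rewrite [leLHS](_ : _ = smax * (D - q i)) // -tE s_sat //.
by field; rewrite gt_eqF.
Qed.

Lemma schedule_energy_le : energy w s <= energy w s'.
Proof.
have [_ dur prec] := sol'.
pose u i := t' i - t i.
have dual : \sum_i s i ^+ 3 * (w i / s' i - w i / s i) <= 0.
  apply: (@le_trans _ _ (\sum_i s i ^+ 3 * (u i - \sum_(p | e p i) u p))).
    apply: ler_sum => i _; rewrite ler_pM2l ?exprn_gt0 //.
    have -> : w i / s i = t i - q i by rewrite -tE addrC addKr.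
    have dE : w i / s' i <= t' i - \sum_(p | e p i) t' p.
      case: (pickP (fun p => e p i)) => [p epi|root].
        by rewrite (sum_parents tree t' epi) lerBrDl prec.
      by rewrite big_pred0 // subr0; exact: (dur i).1.
    by rewrite /u sumrB -/(q i); lra.
  rewrite (eq_bigr (fun i => s i ^+ 3 * u i - \sum_(p | e p i) s i ^+ 3 * u p));
    last by move=> i _; rewrite mulrBr mulr_sumr.
  (* Summation by parts: each edge term is moved to the parent, so that [u i] gets the coefficient
     bounded by [flow_sign]. *)
  rewrite sumrB (exchange_big_dep predT) //= -sumrB sumr_le0 // => i _.
  by rewrite -mulr_suml -mulrBl mulrC; exact: flow_sign.
rewrite /energy; apply: (@le_trans _ _ (\sum_i w i * s' i ^+ 2 +
    2 * \sum_i s i ^+ 3 * (w i / s' i - w i / s i))); last by lra.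
rewrite mulr_sumr -big_split /=; apply: ler_sum => i _.
exact: energy_tangent.
Qed.

End Comparison.

Lemma schedule_solution : (forall i, t i <= D) ->
  solution (continuous_speed smax) w E D s t.
Proof.
move=> tD; split=> [i|i|i j eij]; first by split.
  split=> //; rewrite -tE lerDr; elim/(tree_ind tree): i => [|u v euv IH].
    by rewrite /q (sum_parents_root tree).
  by rewrite (q_child euv) -tE addr_ge0 // divr_ge0 // ltW.
by rewrite /duration -(q_child eij) tE.
Qed.

Lemma schedule_min_energy : (forall i, t i <= D) ->
  min_energy (continuous_speed smax) w E D s t.
Proof.
move=> tD; split; first exact: schedule_solution.
by move=> s' t'; exact: schedule_energy_le.
Qed.

End Optimality.

(** * A cost calculus for commands *)

Section Cost.
Variable R : realType.

(** The cost is only bounded above, so branches of unequal cost share one bound; the postcondition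
    can carry the run of the remaining program. *)
Definition runs (c : cmd) (st : store R) (K : nat) (Q : store R -> Prop) :=
  exists st' k, [/\ exec c st st' k, (k <= K)%N & Q st'].

Lemma runs_le c st K K' (Q : store R -> Prop) :
  runs c st K Q -> (K <= K')%N -> runs c st K' Q.
Proof.
by move=> [st' [k [ex kK Qst]]] KK'; exists st', k; rewrite (leq_trans kK).
Qed.

Lemma runs_skip st (Q : store R -> Prop) : Q st -> runs Skip st 1 Q.
Proof. by move=> ?; exists st, 1%N; split=> //; exact: ExecSkip. Qed.

Lemma runs_iput a i x st (Q : store R -> Prop) :
  Q (iput st a (ieval st i) (ieval st x)) ->
  runs (IPut a i x) st (icost i + icost x).+1 Q.
Proof. by move=> HQ; do 2!eexists; split; [exact: ExecIPut|exact: leqnn|]. Qed.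

Lemma runs_rput a i x v st (Q : store R -> Prop) :
  reval st x = Some v -> Q (rput st a (ieval st i) v) ->
  runs (RPut a i x) st (icost i + rcost x).+1 Q.
Proof.
by move=> xv HQ; do 2!eexists; split; [exact: ExecRPut xv|exact: leqnn|].
Qed.

Lemma runs_seq c1 c2 st K1 K2 (Q : store R -> Prop) :
  runs c1 st K1 (fun st1 => runs c2 st1 K2 Q) ->
  runs (Seq c1 c2) st (K1 + K2) Q.
Proof.
move=> [st1 [k1 [ex1 le1 [st2 [k2 [ex2 le2 HQ]]]]]].
by exists st2, (k1 + k2)%N; split=> //; [exact: ExecSeq ex1 ex2|exact: leq_add].
Qed.

Lemma runs_if b c1 c2 v st K (Q : store R -> Prop) :
  beval st b = Some v -> runs (if v then c1 else c2) st K Q ->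
  runs (If b c1 c2) st (bcost b + K).+1 Q.
Proof.
move=> bv [st' [k [ex le HQ]]]; exists st', (bcost b + k).+1.
by split=> //; [exact: ExecIf bv ex|rewrite ltnS leq_add2l].
Qed.

Definition ivar (a : nat) := IGet a (IConst 0).
Definition rvar (a : nat) := RGet a (IConst 0).

Definition For (x a : nat) (body : cmd) : cmd :=
  Seq (IPut x (IConst 0) (IConst 0))
    (While (BIlt (ivar x) (ivar a))
       (Seq body (IPut x (IConst 0) (ISucc (ivar x))))).

(** An iteration adds 6 for the test and 5 for the increment to [K]; the initialisation costs 3 and
    the last test 6. *)
Lemma runs_for x a body N K (P : nat -> store R -> Prop) st :
  P 0%N (iput st x 0 0) ->
  (forall k st, P k st -> ints st x 0%N = k /\ ints st a 0%N = N) ->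
  (forall k st, (k < N)%N -> P k st ->
     runs body st K (fun st' => P k.+1 (iput st' x 0 (ints st' x 0%N).+1))) ->
  runs (For x a body) st (N * (K + 11) + 9) (P N).
Proof.
move=> P0 Pctr Pbody.
have loop m : forall k st, (k + m)%N = N -> P k st ->
    runs (While (BIlt (ivar x) (ivar a))
       (Seq body (IPut x (IConst 0) (ISucc (ivar x))))) st
       (m * (K + 11) + 6) (P N).
  elim: m => [|m IH] k st1 kmN Pk; have [xk aN] := Pctr _ _ Pk.
    exists st1, 6%N; split=> //; last by rewrite -kmN addn0.
    by apply: ExecWhileDone; rewrite /= xk aN -kmN addn0 ltnn.
  have kN : (k < N)%N by rewrite -kmN addnS ltnS leq_addr.
  have [st2 [k2 [ex2 le2 Pk2]]] := Pbody _ _ kN Pk.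
  have [|st3 [k3 [ex3 le3 PN]]] := IH k.+1 _ _ Pk2; first by rewrite addSnnS.
  have test : beval st1 (BIlt (ivar x) (ivar a)) = Some true.
    by rewrite /= xk aN kN.
  have incr := ExecSeq ex2 (ExecIPut x (IConst 0) (ISucc (ivar x)) st2).
  exists st3; eexists; split; [exact: (ExecWhileLoop test incr ex3)| |by []].
  by rewrite /=; lia.
apply: (@runs_le _ _ (3 + (N * (K + 11) + 6))); last by lia.
by apply: runs_seq; apply: runs_iput; exact: loop P0.
Qed.

End Cost.

(* Integer arrays: 4 and 5 are the outer and inner loop counters; 6 is a copy of
   n, because the last loop clears cell 0 of array 0 to report infeasibility.
   Real arrays: 1 holds the completion times (hence the copy of the deadline in
   8), 3 the sums of the cubed weights of the children, 4 the completion times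
   of the parents, 5 the weights, 7 the speeds. *)
Definition edge_step : cmd :=
  let u := IGet 2 (ivar 5) in
  let v := IGet 3 (ivar 5) in
  let W := RGet 5 v in
  Seq (RPut 3 u (RAdd (RGet 3 u) (RMul W (RMul W W))))
      (RPut 4 v (RAdd (RGet 4 v) (RGet 1 u))).

(** Only cells of index [i] are read from the per-vertex arrays, so updating in place still realises
    a simultaneous round. The last two writes reset the accumulators for the next round. *)
Definition vertex_step : cmd :=
  let i := ivar 5 in
  let slack := RSub (rvar 8) (RGet 4 i) in
  Seq (RPut 5 i (RAdd (RGet 0 i) (RCbrt (RGet 3 i))))
  (Seq (If (BRlt (RGet 5 i) (RMul (rvar 2) slack))
          (RPut 7 i (RDiv (RGet 5 i) slack)) (RPut 7 i (rvar 2)))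
  (Seq (RPut 1 i (RAdd (RGet 4 i) (RDiv (RGet 0 i) (RGet 7 i))))
  (Seq (RPut 3 i (RConst 0)) (RPut 4 i (RConst 0))))).

Definition relax_step : cmd := Seq (For 5 1 edge_step) (For 5 0 vertex_step).

Definition final_step : cmd :=
  let i := ivar 5 in
  Seq (If (BRlt (rvar 8) (RGet 1 i)) (IPut 0 (IConst 0) (IConst 0)) Skip)
      (RPut 0 i (RGet 7 i)).

Definition tree_algorithm : cmd :=
  Seq (RPut 8 (IConst 0) (rvar 1))
  (Seq (IPut 6 (IConst 0) (ivar 0))
  (Seq (For 4 0 relax_step)
  (Seq (For 4 0 relax_step)
       (For 5 6 final_step)))).

(** * The program simulates the relaxation operators *)

Section Correctness.
Variables (R : realType) (n : nat) (w : 'I_n -> R) (E : {set 'I_n * 'I_n}).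
Variables (es : seq ('I_n * 'I_n)) (D smax : R).
Hypotheses (w_gt0 : forall i, 0 < w i) (smax_gt0 : 0 < smax).
Hypotheses (es_uniq : uniq es) (esE : es =i E).

Lemma sum_list_children (f : 'I_n -> R) u :
  \sum_(p <- es | p.1 == u) f p.2 = \sum_(c | edge E u c) f c.
Proof.
rewrite -big_filter big_uniq ?filter_uniq //=.
rewrite (reindex_onto (fun c => (u, c)) snd) /= => [|[x c]]; last first.
  by rewrite mem_filter => /andP[/eqP/= ->].
by apply: eq_bigl => c; rewrite mem_filter /= !eqxx esE andbT.
Qed.

Lemma sum_list_parents (f : 'I_n -> R) v :
  \sum_(p <- es | p.2 == v) f p.1 = \sum_(u | edge E u v) f u.
Proof.
rewrite -big_filter big_uniq ?filter_uniq //=.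
rewrite (reindex_onto (fun u => (u, v)) fst) /= => [|[u x]]; last first.
  by rewrite mem_filter => /andP[/eqP/= ->].
by apply: eq_bigl => u; rewrite mem_filter /= !eqxx esE andbT.
Qed.

(** The memory that relaxation rounds never write. *)
Definition loaded (st : store R) : Prop :=
  [/\ ints st 0%N 0%N = n, ints st 6%N 0%N = n, ints st 1%N 0%N = size es,
      forall k, ints st 2%N k = nth 0%N [seq val p.1 | p <- es] k
    & forall k, ints st 3%N k = nth 0%N [seq val p.2 | p <- es] k] /\
  [/\ reals st 8%N 0%N = D, reals st 2%N 0%N = smax
    & forall i : 'I_n, reals st 0%N i = w i].

Definition work_arrays (r k : nat) (W : 'I_n -> R) (y : 'I_n -> R * R)
    (S Q : 'I_n -> R) (st : store R) : Prop :=
  [/\ loaded st, ints st 4%N 0%N = r, ints st 5%N 0%N = k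
    & forall i : 'I_n, [/\ reals st 5%N i = W i,
        (reals st 7%N i, reals st 1%N i) = y i,
        reals st 3%N i = S i & reals st 4%N i = Q i]].

Let zero (i : 'I_n) : R := 0.

Lemma runs_edges r k W y st : work_arrays r k W y zero zero st ->
  runs (For 5 1 edge_step) st (size es * (36 + 11) + 9)
    (work_arrays r (size es) W y (fun i => \sum_(c | edge E i c) W c ^+ 3)
       (fun i => \sum_(u | edge E u i) (y u).2)).
Proof.
move=> memst.
(* Loop invariant: the accumulators hold the sums over the first [k] listed edges. *)
pose S k i := \sum_(p <- take k es | p.1 == i) W p.2 ^+ 3.
pose Q k i := \sum_(p <- take k es | p.2 == i) (y p.1).2.
have := @runs_for R 5 1 edge_step (size es) 36
  (fun k => work_arrays r k W y (S k) (Q k)) st.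
case.
- have [cst r4 _ arr] := memst; split=> // i; have [? ? ? ?] := arr i.
  by rewrite /S /Q take0 !big_nil.
- by move=> j st1 [[[]]].
- move=> j st1 lt [cst r4 k5 arr]; have [[i0 i6 i1 i2 i3] _] := cst.
  have [p0 _] : exists p0, p0 \in es.
    by case: (es) lt => // p0 ?; exists p0; rewrite inE eqxx.
  case ej : (nth p0 es j) => [u v].
  have uE : ints st1 2%N (ints st1 5%N 0%N) = u.
    by rewrite k5 i2 (nth_map p0) // ej.
  have vE : ints st1 3%N (ints st1 5%N 0%N) = v.
    by rewrite k5 i3 (nth_map p0) // ej.
  have [Wu yu Su Qu] := arr u; have [Wv yv Sv Qv] := arr v.
  eapply runs_le.
    apply: runs_seq; apply: runs_rput; first by [].
    apply: runs_rput; first by [].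
    cbv beta.
    split=> //; first by rewrite /= /upd /= k5.
    move=> i; rewrite /= /upd /= uE vE.
    have [-> yi -> ->] := arr i.
    have yE : reals st1 1%N u = (y u).2 by rewrite -yu.
    rewrite /S /Q (take_nth p0 lt) ej -cats1.
    rewrite !big_cat !big_cons !big_nil /= !addr0.
    rewrite (eq_sym u) (eq_sym v) ![nat_of_ord i == _]val_eqE; split=> //.
      case: (eqVneq i u) => [->|_]; rewrite ?addr0 // Su Wv.
      by rewrite !exprS expr0 mulr1.
    by case: (eqVneq i v) => [->|_]; rewrite ?addr0 // Qv yE.
  by [].
- move=> st' [k' [ex le [cst r4 k5 arr]]]; exists st', k'; split=> //.
  split=> // i; have [-> -> -> ->] := arr i.
  rewrite /S /Q take_size (sum_list_children (fun c => W c ^+ 3)).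
  by rewrite (sum_list_parents (fun p => (y p).2)).
Qed.

Lemma runs_vertices r k W y st :
  (forall i, 0 <= W i) ->
  work_arrays r k W y (fun i => \sum_(c | edge E i c) W c ^+ 3)
       (fun i => \sum_(u | edge E u i) (y u).2) st ->
  runs (For 5 0 vertex_step) st (n * (60 + 11) + 9)
    (work_arrays r n (weights w (edge E) W)
       (schedule w (edge E) D smax (weights w (edge E) W) y) zero zero).
Proof.
move=> W_ge0 memst.
(* Loop invariant: vertices below [k] carry new values, the others still old ones. *)
pose sel T k (f g : 'I_n -> T) (i : 'I_n) := if (i < k)%N then f i else g i.
pose W' := weights w (edge E) W.
have W'_gt0 := weights_gt0 (edge E) w_gt0 W_ge0; rewrite -/W' in W'_gt0.
pose S i := \sum_(c | edge E i c) W c ^+ 3.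
pose q i := \sum_(u | edge E u i) (y u).2.
pose y' := schedule w (edge E) D smax W' y.
have := @runs_for R 5 0 vertex_step n 60
  (fun k => work_arrays r k (sel _ k W' W) (sel _ k y' y)
              (sel _ k zero S) (sel _ k zero q)) st.
case.
- by have [cst r4 _ arr] := memst; split.
- by move=> j st1 [[[]]].
- move=> j st1 lt [cst r4 k5 arr]; have [_ [D8 s2 w0]] := cst.
  pose i := Ordinal lt; have := arr i; rewrite /sel /= ltnn => -[Wi yi Si qi].
  have wi : reals st1 0%N j = w i := w0 i.
  have W'i : W' i = w i + cbrt (S i) by [].
  have y'i : y' i = (speed D smax (W' i) (q i),
                     q i + w i / speed D smax (W' i) (q i)) by [].
  have s_gt0 := speed_gt0 D (q i) smax_gt0 (W'_gt0 i).
  set sp := speed _ _ _ _ in s_gt0 y'i.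
  pose st2 := rput (rput st1 5 j (W' i)) 7 j sp.
  pose Q st' := work_arrays r j.+1 (sel _ j.+1 W' W) (sel _ j.+1 y' y)
    (sel _ j.+1 zero S) (sel _ j.+1 zero q) (iput st' 5 0 (ints st' 5%N 0%N).+1).
  have tail : runs (Seq (RPut 1 (ivar 5) (RAdd (RGet 4 (ivar 5))
                       (RDiv (RGet 0 (ivar 5)) (RGet 7 (ivar 5)))))
      (Seq (RPut 3 (ivar 5) (RConst 0)) (RPut 4 (ivar 5) (RConst 0)))) st2 22 Q.
    eapply runs_le.
      apply: runs_seq; apply: (@runs_rput _ _ _ _ (q i + w i / sp)).
        by rewrite /= /upd /= k5 eqxx wi qi gt_eqF.
      apply: runs_seq; apply: runs_rput; first by [].
      apply: runs_rput; first by [].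
      split=> //; first by rewrite /= /upd /= k5.
      move=> i1; have := arr i1; rewrite /= /upd /= k5 /sel ltnS (leq_eqVlt i1).
      have [i1j _|//] := eqVneq (nat_of_ord i1) j.
      by have -> : i1 = i by [apply: val_inj]; rewrite y'i.
    by [].
  eapply (@runs_le _ _ _ (11 + (13 + 13).+1 + 22)); last by [].
  rewrite -addnA.
  apply: runs_seq; apply: (@runs_rput _ _ _ _ (W' i)).
    by rewrite /= k5 wi Si.
  apply: runs_seq; apply: (@runs_if _ _ _ _ (W' i < smax * (D - q i))).
    by rewrite /= /upd /= k5 eqxx D8 s2 qi.
  rewrite /= k5; case: ifP => slack.
  - apply: (@runs_rput _ _ _ _ sp).
      rewrite /= /upd /= k5 eqxx D8 qi /sp /speed slack.
      (* A zero divisor would make the test read [W' i < 0], against positivity. *)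
      case: eqP => // q0; move: slack; rewrite q0 mulr0.
      by rewrite ltNge ltW.
    by rewrite /= k5.
  - eapply runs_le; first apply: (@runs_rput _ _ _ _ sp).
    + by rewrite /= /upd /= s2 /sp /speed slack.
    + by rewrite /= k5.
    by [].
- move=> st' [k' [ex le [cst r4 k5 arr]]]; exists st', k'; split=> //.
  split=> // i; have := arr i; by rewrite /sel ltn_ord.
Qed.

(** Nonnegative weights make the next weights and speeds positive, so no division gets stuck. *)
Definition state (r : nat) (x : ('I_n -> R) * ('I_n -> R * R)) (st : store R) :=
  (exists k, work_arrays r k x.1 x.2 zero zero st) /\ (forall i, 0 <= x.1 i).

Lemma runs_relax r x st : (size es <= n)%N -> state r x st ->
  runs relax_step st (n * 118 + 18)
    (state r (relax w (edge E) D smax x)).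
Proof.
move=> mn [[k memst] x0].
apply: (@runs_le _ _ _ ((size es * (36 + 11) + 9) + (n * (60 + 11) + 9)));
  last by lia.
apply: runs_seq.
have [st1 [k1 [ex1 le1 mem1]]] := runs_edges memst.
exists st1, k1; split=> //.
have [st2 [k2 [ex2 le2 mem2]]] := runs_vertices x0 mem1.
exists st2, k2; split=> //; split; first by exists n.
by move=> i; apply: ltW; apply: weights_gt0.
Qed.

Lemma runs_relaxations r x st : (size es <= n)%N -> state r x st ->
  runs (For 4 0 relax_step) st (n * (n * 118 + 18 + 11) + 9)
    (state n (iter n (relax w (edge E) D smax) x)).
Proof.
move=> mn sts.
apply: (@runs_for R 4 0 relax_step n _
  (fun k => state k (iter k (relax w (edge E) D smax) x))) => [|k st1|k st1 kn stk].
- by case: sts => [[k [? ? ? ?]] ?]; split=> //; exists k.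
- by move=> [[j [[[]]]]].
have [st2 [k2 [ex2 le2 [[j [cst r4 k5 arr]] x0]]]] := runs_relax mn stk.
exists st2, k2; split=> //; split=> //; exists j; split=> //.
by rewrite /= r4.
Qed.

Lemma runs_final r x st : (0 < n)%N -> state r x st ->
  runs (For 5 6 final_step) st (n * (16 + 11) + 9) (fun st' =>
    [/\ (ints st' 0%N 0%N == 0%N) = [exists i, D < (x.2 i).2],
        forall i : 'I_n, reals st' 0%N i = (x.2 i).1
      & forall i : 'I_n, reals st' 1%N i = (x.2 i).2]).
Proof.
move=> n_gt0 [[k [[[i0 i6 i1 i2 i3] [D8 s2 w0]] r4 k5 arr]] _].
pose late j := [exists i : 'I_n, (i < j)%N && (D < (x.2 i).2)].
pose P j (st' : store R) := [/\ ints st' 5%N 0%N = j /\ ints st' 6%N 0%N = n,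
  reals st' 8%N 0%N = D, (ints st' 0%N 0%N == 0%N) = late j,
  forall i : 'I_n, (i < j)%N -> reals st' 0%N i = (x.2 i).1
  & forall i : 'I_n, (reals st' 7%N i, reals st' 1%N i) = x.2 i].
have := @runs_for R 5 6 final_step n 16 P st; case.
- split=> // [|i]; last by have [_ -> _ _] := arr i.
  (* Before any vertex is examined the flag cell holds [n], which is nonzero and so reports
     feasibility. *)
  rewrite /= /upd /= i0 eqn0Ngt n_gt0; apply/esym/existsP => -[i].
  by rewrite ltn0.
- by move=> j st1 [[]].
- move=> j st1 lt [[k5' i6'] D8' late0 sj yj].
  pose i := Ordinal lt.
  have yi : (reals st1 7%N j, reals st1 1%N j) = x.2 i := yj i.
  have lateS : late j.+1 = (D < (x.2 i).2) || late j.
    apply/existsP/orP => [[i' /andP[]]|[Di|/existsP[i' /andP[i'j Di']]]].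
    + rewrite ltnS leq_eqVlt => /orP[/eqP i'j|i'j] Di'; last first.
        by right; apply/existsP; exists i'; rewrite i'j.
      by left; have -> : i = i' by apply: val_inj.
    + by exists i; rewrite ltnSn.
    + by exists i'; rewrite ltnW.
  pose Q st' := P j.+1 (iput st' 5 0 (ints st' 5%N 0%N).+1).
  have tail st2 : ints st2 5%N 0%N = j -> ints st2 6%N 0%N = n ->
      reals st2 = reals st1 -> (ints st2 0%N 0%N == 0%N) = late j.+1 ->
      runs (RPut 0 (ivar 5) (RGet 7 (ivar 5))) st2 6 Q.
    move=> k5'' i6'' st2E late2; apply: runs_rput; first by [].
    rewrite /= k5'' st2E; split; rewrite /= /upd /= ?k5'' ?st2E //.
    move=> i'; rewrite ltnS (leq_eqVlt i').
    have [i'j _|_] := eqVneq (nat_of_ord i') j; last exact: sj.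
    by have -> : i' = i by [apply: val_inj]; rewrite -yi.
  eapply (@runs_le _ _ _ (10 + 6)); last by [].
  apply: runs_seq.
  apply: (@runs_if _ _ _ _ (D < (x.2 i).2) _ 3).
    by rewrite /= k5' D8' -yi.
  case: ifP => Di.
    by apply: runs_iput; apply: tail => //; rewrite lateS Di.
  apply: (runs_le (K := 1)) => //; apply: runs_skip; apply: tail => //.
  by rewrite lateS Di.
- move=> st' [k' [ex le [_ _ late' sj yj]]]; exists st', k'; split=> //.
  split=> [|i|i]; last by rewrite -yj.
    by rewrite late'; apply: eq_existsb => i; rewrite ltn_ord.
  exact: sj.
Qed.

End Correctness.

Theorem theorem2 :
  exists (algo : cmd) (C : nat),
    forall (R : realType) (n : nat) (w : 'I_n -> R) (E : {set 'I_n * 'I_n})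
      (D smax : R) (T0 : 'I_n) (es : seq ('I_n * 'I_n)),
      (forall i, 0 < w i) -> 0 < D -> 0 < smax ->
      acyclic (edge E) -> tree_rooted_in (edge E) T0 ->
      uniq es -> es =i E ->
      exists (st : store R) (k : nat),
        [/\ exec algo (input w es D smax) st k,
            (k <= C * n ^ 2)%N
          & match output n st with
            | Some (s, t) => min_energy (continuous_speed smax) w E D s t
            | None => ~ exists s t, solution (continuous_speed smax) w E D s t
            end].
Proof.
(* The bounds add up to [236 * n ^ 2 + 85 * n + 35]; as [n] is positive, 800 leaves room. *)
exists tree_algorithm, 800%N => R n w E D smax T0 es.
move=> w0 _ s0 acyc tree es_uniq esE.
have n0 : (0 < n)%N by apply: leq_trans (ltn_ord T0).
have mn : (size es <= n)%N.
  have -> : size es = #|E| by rewrite -(card_uniqP es_uniq); exact: eq_card.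
  by rewrite -[leqRHS]card_ord; exact: (tree_edge_card tree).
set st0 := input w es D smax.
(* The array of completion times starts with the deadline in cell 0. This is harmless: the fixpoint
   is reached from any start. *)
pose x0 : ('I_n -> R) * ('I_n -> R * R) :=
  (fun=> 0, fun i : 'I_n => (0, reals st0 1%N i)).
pose step := relax w (edge E) D smax.
pose x := iter n step (iter n step x0).
pose Q (st' : store R) := (forall i, 0 <= x.1 i) /\
    [/\ (ints st' 0%N 0%N == 0%N) = [exists i, D < (x.2 i).2],
        forall i : 'I_n, reals st' 0%N i = (x.2 i).1
      & forall i : 'I_n, reals st' 1%N i = (x.2 i).2].
have [st [k [ex kn [x_ge0 [late sE tE]]]]] :
    runs tree_algorithm st0 (800 * n ^ 2) Q.
  eapply runs_le.
    apply: runs_seq; apply: runs_rput; first by [].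
    apply: runs_seq; apply: runs_iput.
    apply: runs_seq.
    have [|st1 [k1 [ex1 le1 state1]]] :=
      @runs_relaxations R n w E es D smax w0 s0 es_uniq esE 0 x0
        (iput (rput st0 8 0 D) 6 0 n) mn.
      split=> //; exists 0%N; split=> //.
      by split; split=> // i; rewrite /= /upd /= valK.
    exists st1, k1; split=> //; first exact: le1.
    apply: runs_seq.
    have [st2 [k2 [ex2 le2 state2]]] :=
      runs_relaxations w0 s0 es_uniq esE mn state1.
    exists st2, k2; split=> //; first exact: le2.
    have [st3 [k3 [ex3 le3 Q3]]] := runs_final n0 state2.
    exists st3, k3; split=> //; first exact: le3.
    by split=> //; case: state2.
  by rewrite /=; nia.
exists st, k; split=> //.
have [WE yE] := iter_relax_fixpoint w D smax x0 acyc; rewrite -/x in WE yE.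
pose s i := (x.2 i).1; pose t i := (x.2 i).2.
have speedE i : speed D smax (x.1 i) (\sum_(u | edge E u i) t u) = s i.
  by rewrite /s -[in RHS]yE.
have complE i : \sum_(u | edge E u i) t u + w i / s i = t i.
  by rewrite /t -[in RHS]yE /schedule /= speedE.
rewrite /output late; case: existsP => [[i Di] [s' [t' sol']]|ontime].
  have := schedule_meets_deadline w0 s0 tree x_ge0 WE speedE complE sol' i.
  by rewrite leNgt Di.
have td i : t i <= D.
  by rewrite leNgt; apply/negP => Di; apply: ontime; exists i.
have [[adm dur prec] opt] :=
  schedule_min_energy w0 s0 tree x_ge0 WE speedE complE td.
split; first split.
- by move=> i; rewrite sE; exact: adm.
- by move=> i; rewrite /duration sE tE; exact: dur.
- by move=> i j; rewrite /duration sE !tE; exact: prec.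
move=> s' t' /opt; apply: le_trans; rewrite (_ : energy w _ = energy w s) //.
by apply: eq_bigr => i _; rewrite sE.
Qed.
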